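(* There exists $d_0$ such that for all integers $d\ge d_0$, $$N_d\ \le\ d+3\sqrt{d\ln d}.$$
   Context: Let $\mathcal{S}_n$ be the set of all permutations of $\{1,\ldots,n\}$, written as sequences $\mathbf{x}=x_1\ldots x_n$. For $1\le k\le n$, a $k$-minor of $\mathbf{x}\in\mathcal{S}_n$ is a subsequence of $\mathbf{x}$ of length $k$ (entries taken in increasing index positions) whose entries are renumbered by $1,2,\ldots,k$ preserving their relative order. The $k$-deck $D_k(\mathbf{x})$ is the multiset of all $\binom{n}{k}$ $k$-minors of $\mathbf{x}$ (one for each choice of $k$ index positions). For a positive integer $d$, $N_d$ denotes the smallest integer $N>d$ such that for every $n\ge N$, every permutation of length $n$ can be reconstructed from its $(n-d)$-deck, i.e. $D_{n-d}(\mathbf{x})\neq D_{n-d}(\mathbf{y})$ for all distinct $\mathbf{x},\mathbf{y}\in\mathcal{S}_n$. (It is known that $N_d$ exists for every $d$.) Here $\ln$ is the natural logarithm. *)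

(* Defs.v *)
From HB Require Import structures.
From mathcomp Require Import all_boot all_order all_algebra all_fingroup.
From mathcomp Require Import finmap multiset.
From mathcomp Require Import reals exp.

Set Implicit Arguments.
Unset Strict Implicit.
Unset Printing Implicit Defensive.

Local Open Scope nat_scope.

(* A permutation x_1 ... x_n of {1, ..., n} is an element x of 'S_n; since 'I_n
   is {0, ..., n-1}, the entry x_(i+1) is (x i).+1.  [enum A] lists the set of
   positions A increasingly. *)
Definition subword (n : nat) (x : 'S_n) (A : {set 'I_n}) : seq nat :=
  [seq (x i).+1 | i <- enum A].

(* Each entry is replaced by its rank (counted from 1) among the entries; for a
   word with distinct entries this is the order-preserving renumbering by
   1, ..., size s. *)
Definition renumber (s : seq nat) : seq nat :=
  [seq count (fun b => b <= a) s | a <- s].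

Definition minor (n : nat) (x : 'S_n) (A : {set 'I_n}) : seq nat :=
  renumber (subword x A).

Definition deck (n k : nat) (x : 'S_n) : {mset (seq nat)}%mset :=
  seq_mset [seq minor x A | A <- enum [set A : {set 'I_n} | #|A| == k]].

Definition all_reconstructible (n k : nat) : Prop :=
  forall x y : 'S_n, x <> y -> deck k x <> deck k y.

Definition admissible (d N : nat) : Prop :=
  d < N /\ forall n : nat, N <= n -> all_reconstructible n (n - d).

(* N = N_d: the least admissible N. *)
Definition is_Nd (d N : nat) : Prop :=
  admissible d N /\ forall M : nat, admissible d M -> N <= M.

(* Main.v *)
Require Import Defs.
From mathcomp Require Import all_boot all_order all_algebra all_fingroup.
From mathcomp Require Import finmap multiset.
From mathcomp Require Import boolp reals sequences exp.
From mathcomp Require Import zify ring lra.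

Set Implicit Arguments.
Unset Strict Implicit.
Unset Printing Implicit Defensive.

Import Order.TTheory GRing.Theory Num.Theory.
Local Open Scope ring_scope.

(** The k-deck of x determines every count of m-tuples of points of the graph
    of x, m <= k, that are selected by the relative order of their positions
    and of their values: such a count is a weighted count over the k-minors
    ([deck_order_stat]).  Positions and values are numbered from 0.  Since
    x_j * j^a counts the tuples (s_1, ..., s_a, j, l) with all s_i < j and
    x_l < x_j, the sums of x_j * j^a are determined for a <= k - 2.  So if x
    and y have the same k-deck, then z_j = x_j - y_j satisfies
    sum_j z_j g(j) = 0 for every polynomial g of degree at most k - 2
    ([deck_poly_sum]).

    If x and y differ, let i be the first position where they do.  A
    contradiction follows from a polynomial g of degree at most k - 2 whose
    value at i exceeds n times the sum of its absolute values at the later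
    positions, because z_i is a nonzero integer and |z_j| <= n.  Take, in the
    variable t = j - i,
      g(t) = (1 - t)(1 - t/2)...(1 - t/L) * a_m(t/n)^(2(L+2)),
    where a_m is the polynomial of degree m with
    sin((2m+1)u) = sin u * a_m((sin u)^2).  It satisfies a_m(0) = 2m+1 and
    a_m(v)^2 <= 1/v on ]0, 1].  The first factor vanishes at 1, ..., L and is at
    most t^L / L! in absolute value at every positive integer; so
    |g(t)| <= n^(L+2) / (L! t^2), and these bounds sum to at most
    2 n^(L+2) / L!.  As g has degree (L+2)(2m+1) - 2 and g(0) is
    (2m+1)^(2(L+2)), permutations of length n are reconstructible from the
    k-deck as soon as 2 n^(L+3) < L! (2m+1)^(2(L+2)) and (L+2)(2m+1) <= k
    ([reconstructible_of_kernel]).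

    The choice L ~ 1.01 ln n and 2m+1 ~ e sqrt(n/L) meets the first condition
    by L! >= (L/e)^L, and gives degree about e sqrt(1.01 n ln n), below
    2.9 sqrt(n ln n) ([exists_params]).  When n > d + 3 sqrt(d ln d) - 1 and d
    is large, this is at most n - d ([minor_length_large]). *)

(** * Statistics determined by the deck *)

Lemma renumber_ltn (s : seq nat) p q : (p < size s)%N -> (q < size s)%N ->
  (nth 0 (renumber s) p < nth 0 (renumber s) q)%N = (nth 0 s p < nth 0 s q)%N.
Proof.
move=> ps qs; rewrite /renumber !(nth_map 0%N) //.
set a := nth _ _ p; set b := nth _ _ q.
case: (ltnP a b) => [ab|ba].
  have -> : count (fun c => (c <= b)%N) s =
      (count (fun c => (c <= a)%N) s + count (fun c => (a < c <= b)%N) s)%N.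
    rewrite -count_predUI [X in (_ + X)%N](@eq_count _ _ pred0); last first.
      by move=> c /=; lia.
    by rewrite count_pred0 addn0; apply: eq_count => c /=; lia.
  rewrite -[X in (X < _)%N]addn0 ltn_add2l -has_count; apply/hasP.
  by exists b; rewrite ?mem_nth // ab leqnn.
apply/negbTE; rewrite -leqNgt; apply: sub_count => c /= cb.
exact: leq_trans cb ba.
Qed.

Section OrderStatistics.
Variables (F : numFieldType) (n k : nat) (o : 'I_n).
Implicit Types (x y : 'S_n) (A B : {set 'I_n}).

Lemma nth_enum_ltn A p q : (p < #|A|)%N -> (q < #|A|)%N ->
  (nth o (enum A) p < nth o (enum A) q)%N = (p < q)%N.
Proof.
have srt : sorted (relpre val ltn) (enum A).
  rewrite /enum_mem; apply: sorted_filter => [? ? ?|]; first exact: ltn_trans.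
  by rewrite -enumT -sorted_map val_enum_ord iota_ltn_sorted.
have mono i j : (i < j)%N -> (j < #|A|)%N ->
    (nth o (enum A) i < nth o (enum A) j)%N.
  move=> ij jA; apply: (sorted_ltn_nth _ _ srt) => //=.
  - by move=> ? ? ?; apply: ltn_trans.
  - by rewrite inE -cardE (ltn_trans ij).
  - by rewrite inE -cardE.
move=> pA qA; case: (ltngtP p q) => [pq|qp|->]; last by rewrite ltnn.
  exact: mono.
by apply/negbTE; rewrite -leqNgt ltnW // mono.
Qed.

(** Complementation turns the k-sets containing [B] into the (n - k)-subsets of
    the complement of [B]. *)
Lemma card_supersets B : (k <= n)%N ->
  #|[set A : {set 'I_n} | (#|A| == k) && (B \subset A)]| = 'C(n - #|B|, n - k).
Proof.
move=> kn.
have cardC (C : {set 'I_n}) : #|~: C| = (n - #|C|)%N by rewrite cardsCs setCK card_ord.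
rewrite -cardC -cards_draws -[LHS](card_imset _ (@setC_inj _)).
apply: eq_card => A; apply/imsetP/idP => [[C + ->]|].
  by rewrite !inE => /andP[/eqP Ck BC]; rewrite setCS BC cardC Ck eqxx.
rewrite !inE => /andP[AB /eqP Ak]; exists (~: A); last by rewrite setCK.
by rewrite !inE -(setCK B) setCS AB cardC Ak subKn // eqxx.
Qed.

(** [Psi] receives only the order of the positions and the order of the values
    of the points indexed by [f]. *)
Definition order_stat m (Psi : rel 'I_m -> rel 'I_m -> F) x
    (f : {ffun 'I_m -> 'I_n}) : F :=
  Psi (fun i j => f i < f j)%N (fun i j => x (f i) < x (f j))%N.

(** Double counting: the image of [f] has at most m <= k elements, so it lies in
    a positive number of k-subsets, and the weight is the inverse of that
    number. *)
Lemma sum_over_supports m (G : {ffun 'I_m -> 'I_n} -> F) :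
  (m <= k <= n)%N ->
  \sum_f G f = \sum_(A in [set A : {set 'I_n} | #|A| == k])
    \sum_(f : {ffun 'I_m -> 'I_n} | f @: setT \subset A)
      G f / 'C(n - #|f @: setT|, n - k)%:R.
Proof.
move=> /andP[mk kn]; under [RHS]eq_bigr do rewrite big_mkcond /=.
rewrite exchange_big /=; apply: eq_bigr => f _.
rewrite -big_mkcondr /= sumr_const.
have card_eq : #|[set A : {set 'I_n} | (#|A| == k) && (f @: setT \subset A)]| =
    'C(n - #|f @: setT|, n - k) by exact: card_supersets.
rewrite (eq_card (B := [set A : {set 'I_n} |
    (#|A| == k) && (f @: setT \subset A)])); last first.
  by move=> A; rewrite unfold_in !inE.
rewrite card_eq.
rewrite -[RHS]mulr_natr divfK // pnatr_eq0 -lt0n bin_gt0 leq_sub2l //.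
apply: leq_trans mk; apply: leq_trans (leq_imset_card _ _) _.
by rewrite cardsT card_ord.
Qed.

(** The share of one minor [w] in the sum of an order statistic over all maps:
    the maps into a k-set are transported to maps into 'I_k, and [w] knows the
    order of its own entries. *)
Definition minor_stat m (Psi : rel 'I_m -> rel 'I_m -> F) (w : seq nat) : F :=
  \sum_(h : {ffun 'I_m -> 'I_k})
    Psi (fun i j => h i < h j)%N (fun i j => nth 0 w (h i) < nth 0 w (h j))%N
      / 'C(n - #|h @: setT|, n - k)%:R.

(** The increasing enumeration of [A] identifies 'I_k with [A]; it preserves the
    order of positions, and renumbering preserves the order of values. *)
Lemma minor_statE m (Psi : rel 'I_m -> rel 'I_m -> F) x A : #|A| = k ->
  \sum_(f : {ffun 'I_m -> 'I_n} | f @: setT \subset A)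
     order_stat Psi x f / 'C(n - #|f @: setT|, n - k)%:R
  = minor_stat Psi (minor x A).
Proof.
move=> Ak; pose e (i : 'I_k) : 'I_n := nth o (enum A) i.
have sE : size (enum A) = k by rewrite -cardE.
have e_inj : injective e.
  move=> i j /eqP; rewrite nth_uniq ?enum_uniq ?sE //.
  by move=> /eqP/val_inj.
have eA i : e i \in A by rewrite -mem_enum mem_nth // sE.
have e_lt i j : (e i < e j)%N = (i < j)%N by rewrite nth_enum_ltn ?Ak.
have e_val (i j : 'I_k) : (nth 0 (minor x A) i < nth 0 (minor x A) j)%N
    = (x (e i) < x (e j))%N.
  by rewrite renumber_ltn ?size_map ?sE // !(nth_map o) ?sE // ltnS.
pose up (h : {ffun 'I_m -> 'I_k}) := [ffun i => e (h i)].
have up_inj : injective up.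
  by move=> g h /ffunP gh; apply/ffunP => i; move: (gh i); rewrite !ffunE => /e_inj.
have upE : [set f : {ffun 'I_m -> 'I_n} | f @: setT \subset A] = up @: setT.
  apply/setP => f; rewrite inE; apply/idP/imsetP => [/subsetP fA|[h _ ->]].
    have /fin_all_exists[h hE] i : exists j, f i = e j.
      have fiA : f i \in enum A by rewrite mem_enum fA // imset_f.
      move: (fiA); rewrite -index_mem sE => fik.
      by exists (Ordinal fik); rewrite /e nth_index.
    by exists [ffun i => h i] => //; apply/ffunP => i; rewrite !ffunE.
  by apply/subsetP => _ /imsetP[i _ ->]; rewrite ffunE.
transitivity (\sum_(f in up @: setT)
    order_stat Psi x f / 'C(n - #|f @: setT|, n - k)%:R).
  by apply: eq_bigl => f; rewrite -upE inE.
rewrite big_imset /=; last by move=> ? ? _ _ /up_inj.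
rewrite /minor_stat; apply: eq_big => [h|h _]; first by rewrite inE.
congr (_ / _%:R).
  rewrite /order_stat; congr Psi; apply/funext => i; apply/funext => j.
    by rewrite !ffunE e_lt.
  by rewrite !ffunE e_val.
have -> : up h @: setT = e @: (h @: setT).
  by rewrite -imset_comp; apply: eq_imset => i; rewrite /= ffunE.
by rewrite (card_imset _ e_inj).
Qed.

Lemma deck_order_stat m (Psi : rel 'I_m -> rel 'I_m -> F) x y :
  (m <= k <= n)%N -> deck k x = deck k y ->
  \sum_f order_stat Psi x f = \sum_f order_stat Psi y f.
Proof.
move=> mkn /eq_seq_msetP xy.
have dsum z : \sum_f order_stat Psi z f =
    \sum_(w <- [seq minor z A | A <- enum [set A : {set 'I_n} | #|A| == k]])
       minor_stat Psi w.
  rewrite (sum_over_supports _ mkn) big_map big_enum /=; apply: eq_bigr => A.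
  by rewrite inE => /eqP Ak; rewrite minor_statE.
by rewrite !dsum (perm_big _ xy).
Qed.

Lemma sum_ltn_ord (j : 'I_n) : \sum_(s < n) (s < j)%N%:R = j%:R :> F.
Proof.
rewrite -natr_sum; congr _%:R; under eq_bigr do rewrite -[nat_of_bool _]mul1n.
rewrite -[LHS]/(\sum_(s < n) 1 * (s < j))%N.
have -> : (\sum_(s < n) 1 * (s < j) = \sum_(s < n | s < j) 1)%N.
  by rewrite [RHS]big_mkcond; apply: eq_bigr => s _; case: ltnP.
by rewrite (big_ord_narrow (ltnW (ltn_ord j))) sum_nat_const card_ord muln1.
Qed.

(** Indicator that index 1 has a smaller value than index 0, and that the
    indices 2, ..., a+1 sit at earlier positions than index 0. *)
Definition below_stat a (P V : rel 'I_a.+2) : F :=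
  (V (lift ord0 ord0) ord0)%:R * \prod_(i < a) (P (lift ord0 (lift ord0 i)) ord0)%:R.

(** For a fixed point j at index 0, the remaining indices are chosen
    independently: x_j ways for index 1, and j ways for each of the others. *)
Lemma sum_below_stat a x :
  \sum_f order_stat (@below_stat a) x f = \sum_j (x j)%:R * j%:R ^+ a.
Proof.
pose c (j : 'I_n) (i : 'I_a.+2) (s : 'I_n) : F :=
  match val i with 0%N => (j == s)%:R | 1%N => (x s < x j)%N%:R | _ => (s < j)%N%:R end.
have cE j : \prod_i \sum_s c j i s = (x j)%:R * j%:R ^+ a.
  rewrite !big_ord_recl /c /=; have -> : \sum_s (j == s)%:R = 1 :> F.
    rewrite (bigD1 j) //= eqxx big1 ?addr0 // => s /negbTE.
    by rewrite eq_sym => ->.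
  rewrite mul1r sum_ltn_ord prodr_const card_ord; congr (_ * _).
  by rewrite -(sum_ltn_ord (x j)) [RHS](reindex_inj (@perm_inj _ x)).
under [RHS]eq_bigr do rewrite -cE bigA_distr_bigA.
(* In the sum over j, only j = f 0 contributes. *)
rewrite exchange_big /=; apply: eq_bigr => f _.
rewrite (bigD1 (f ord0)) //= [X in _ = _ + X]big1 ?addr0 => [|j jf].
  by rewrite /order_stat /below_stat !big_ord_recl /c /= eqxx mul1r.
by rewrite big_ord_recl /c /= (negbTE jf) mul0r.
Qed.

Lemma deck_poly_sum x y (g : {poly F}) : (k <= n)%N -> (size g < k)%N ->
  deck k x = deck k y ->
  \sum_j ((x j)%:R - (y j)%:R) * g.[j%:R] = 0.
Proof.
move=> kn gk xy.
have pow a : (a.+2 <= k)%N -> \sum_j ((x j)%:R - (y j)%:R) * j%:R ^+ a = 0 :> F.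
  move=> ak; under eq_bigr do rewrite mulrBl.
  rewrite sumrB -!sum_below_stat (@deck_order_stat _ _ x y) ?subrr //.
  by rewrite ak.
under eq_bigr do rewrite horner_coef mulr_sumr.
rewrite exchange_big big1 //= => a _.
under eq_bigr do rewrite mulrCA.
by rewrite -mulr_sumr pow ?mulr0 // (leq_ltn_trans _ gk).
Qed.

End OrderStatistics.

(** * A polynomial concentrated at the origin *)

Section OddChebyshev.
Variable F : realFieldType.

(** The pair (a_m, b_m) with sin((2m+1)u) = sin u * a_m((sin u)^2) and
    cos((2m+1)u) = cos u * b_m((sin u)^2); the recursion is the addition
    formula for the angle 2u. *)
Fixpoint pell (m : nat) : {poly F} * {poly F} :=
  if m is m'.+1 then
    let: (a, b) := pell m' in
    (a * (1 - 'X *+ 2) + (1 - 'X) * b *+ 2, b * (1 - 'X *+ 2) - 'X * a *+ 2)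
  else (1, 1).

(** The identity sin^2 + cos^2 = 1 at the angle (2m+1)u. *)
Lemma pell_identity m :
  'X * (pell m).1 ^+ 2 + (1 - 'X) * (pell m).2 ^+ 2 = 1.
Proof.
elim: m => [|m] /=; first by ring.
case: (pell m) => a b /= IH; rewrite -[RHS]IH; ring.
Qed.

Lemma pell_le m t : 0 <= t <= 1 -> t * (pell m).1.[t] ^+ 2 <= 1.
Proof.
move=> /andP[t0 t1]; have := congr1 (fun p => p.[t]) (pell_identity m).
rewrite -{1}polyC1 !(hornerD, hornerN, hornerM, horner_exp, hornerX, hornerC).
by move=> tE; rewrite -[leRHS]tE lerDl mulr_ge0 ?sqr_ge0 // subr_ge0.
Qed.

Lemma pell_at0 m : (pell m).1.[0] = (2 * m + 1)%:R.
Proof.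
suff [] : (pell m).1.[0] = (2 * m + 1)%:R /\ (pell m).2.[0] = 1 by [].
elim: m => [|m] /=; first by rewrite !hornerE.
case: (pell m) => a b /= [a0 b0].
rewrite -!polyC1 !(hornerD, hornerN, hornerM, hornerMn, hornerX, hornerC) a0 b0.
by rewrite mulnS !natrD; split; ring.
Qed.

Lemma size_pell m : (size (pell m).1 <= m.+1)%N.
Proof.
suff [] : (size (pell m).1 <= m.+1)%N /\ (size (pell m).2 <= m.+1)%N by [].
elim: m => [|m] /=; first by rewrite !size_poly1.
case: (pell m) => a b /= [sa sb].
have mulX (p : {poly F}) : (size p <= m.+1 -> size ('X * p)%R <= m.+2)%N.
  by move=> sp; apply: leq_trans (size_polyMleq _ _) _; rewrite size_polyX.
have addle (p q : {poly F}) : (size p <= m.+2 -> size q <= m.+2 -> size (p + q)%R <= m.+2)%N.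
  by move=> sp sq; apply: leq_trans (size_polyD _ _) _; rewrite geq_max sp sq.
have -> : a * (1 - 'X *+ 2) + (1 - 'X) * b *+ 2
    = (a + (b + b)) + - ('X * (a + a + (b + b))) by ring.
have -> : b * (1 - 'X *+ 2) - 'X * a *+ 2 = b + - ('X * (a + a + (b + b))) by ring.
have sD (p q : {poly F}) : (size p <= m.+1 -> size q <= m.+1 -> size (p + q)%R <= m.+1)%N.
  by move=> sp sq; apply: leq_trans (size_polyD _ _) _; rewrite geq_max sp sq.
have sab := mulX _ (sD _ _ (sD _ _ sa sa) (sD _ _ sb sb)).
by split; apply: addle; rewrite ?size_polyN //; apply: leqW; rewrite // !sD.
Qed.

Definition kernel (L m n : nat) : {poly F} :=
  (\prod_(i < L) (1 - i.+1%:R^-1 *: 'X)) *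
  ((pell m).1 \Po (n%:R^-1 *: 'X)) ^+ (2 * (L + 2)).

Lemma size_kernel L m n : (size (kernel L m n) <= L + m * (2 * (L + 2)) + 1)%N.
Proof.
apply: leq_trans (size_polyMleq _ _) _.
have s1 : (size (\prod_(i < L) (1 - i.+1%:R^-1 *: 'X) : {poly F})%R <= L.+1)%N.
  elim: L => [|L IH]; first by rewrite big_ord0 size_poly1.
  rewrite big_ord_recr /=; apply: leq_trans (size_polyMleq _ _) _.
  have : (size (1 - L.+1%:R^-1 *: 'X : {poly F})%R <= 2)%N.
    apply: leq_trans (size_polyD _ _) _; rewrite size_poly1 geq_max /= size_polyN.
    by rewrite (leq_trans (size_scale_leq _ _)) // size_polyX.
  by move=> /(leq_add IH) sAB; rewrite -subn1 leq_subLR (leq_trans sAB) // addn2.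
have s2 : (size (((pell m).1 \Po (n%:R^-1 *: 'X)) ^+ (2 * (L + 2)))%R <= (m * (2 * (L + 2))).+1)%N.
  apply: leq_trans (size_poly_exp_leq _ _) _; rewrite ltnS leq_mul2r; apply/orP; right.
  rewrite -subn1 leq_subLR add1n (leq_trans (size_comp_poly_leq _ _)) // ltnS.
  rewrite -[leqRHS]muln1 leq_mul // -subn1 leq_subLR add1n ?size_pell //.
  by rewrite (leq_trans (size_scale_leq _ _)) // size_polyX.
rewrite -subn1 leq_subLR (leq_trans (leq_add s1 s2)) //.
by lia.
Qed.

Lemma kernel_at0 L m n : (kernel L m n).[0] = (2 * m + 1)%:R ^+ (2 * (L + 2)).
Proof.
rewrite /kernel hornerM horner_prod big1 => [|i _]; last first.
  by rewrite hornerD hornerN hornerZ hornerX mulr0 subr0 -polyC1 hornerC.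
by rewrite mul1r horner_exp horner_comp hornerZ hornerX mulr0 pell_at0.
Qed.

(** For t <= L one factor vanishes; for t > L every factor 1 - t/(i+1) has
    absolute value t/(i+1) - 1. *)
Lemma zeros_le L t : (0 < t)%N ->
  `|\prod_(i < L) (1 - i.+1%:R^-1 * t%:R)| <= t%:R ^+ L / L`!%:R :> F.
Proof.
move=> t0; have [tL|Lt] := leqP t L.
  have tL' : (t.-1 < L)%N by lia.
  rewrite (bigD1 (Ordinal tL')) //= prednK // mulVf ?subrr ?mul0r ?normr0.
    by rewrite divr_ge0 ?exprn_ge0.
  by rewrite pnatr_eq0 -lt0n.
elim: L Lt => [_|L IH Lt]; first by rewrite big_ord0 expr0 fact0 normr1 divr1.
have -> : t%:R ^+ L.+1 / (L.+1)`!%:R = t%:R ^+ L / L`!%:R * (t%:R / L.+1%:R) :> F.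
  by rewrite exprSr factS mulnC natrM invfM mulrACA.
rewrite big_ord_recr /= normrM ler_pM ?IH 1?ltnW //.
rewrite [_^-1 * _]mulrC ler_norml; have : 1 <= t%:R / L.+1%:R :> F.
  by rewrite ler_pdivlMr ?ltr0n // mul1r ler_nat ltnW.
by move: (t%:R / L.+1%:R) => q q1; apply/andP; split; lra.
Qed.

(** The exponent L + 2 of n/t absorbs t^L and leaves the summable 1/t^2. *)
Lemma kernel_le L m n t : (0 < t <= n)%N ->
  `|(kernel L m n).[t%:R]| <= n%:R ^+ (L + 2) / L`!%:R / t%:R ^+ 2.
Proof.
move=> /andP[t0 tn]; have n0 := leq_trans t0 tn.
have t0' : (0 : F) < t%:R by rewrite ltr0n.
have n0' : (0 : F) < n%:R by rewrite ltr0n.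
rewrite /kernel hornerM horner_prod normrM.
have -> : n%:R ^+ (L + 2) / L`!%:R / t%:R ^+ 2 =
    (t%:R ^+ L / L`!%:R) * (n%:R / t%:R) ^+ (L + 2) :> F.
  rewrite expr_div_n [_ ^+ (L + 2) in X in _ = _ * (_ / X)]exprD; field.
  by rewrite !gt_eqF ?exprn_gt0 // ltr0n fact_gt0.
apply: ler_pM => //.
  rewrite (eq_bigr (fun i : 'I_L => 1 - i.+1%:R^-1 * t%:R)) ?zeros_le // => i _.
  by rewrite -polyC1 !(hornerD, hornerN, hornerZ, hornerX, hornerC).
rewrite horner_exp horner_comp hornerZ hornerX normrX exprM lerXn2r ?nnegrE //.
- by rewrite exprn_ge0.
- by rewrite divr_ge0 ?ltW.
rewrite real_normK ?num_real // ler_pdivlMr //.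
have tn01 : 0 <= (n%:R^-1 * t%:R : F) <= 1.
  by apply/andP; split; [rewrite mulr_ge0 ?invr_ge0|rewrite ler_pdivrMl // mulr1 ler_nat].
by have := pell_le m tn01; rewrite -mulrA ler_pdivrMl // mulr1 mulrC.
Qed.

Lemma kernel_sum_le L m n :
  \sum_(1 <= t < n) `|(kernel L m n).[t%:R]| <= 2 * (n%:R ^+ (L + 2) / L`!%:R).
Proof.
(* Telescoping: 1/(k+1)^2 <= 1/k - 1/(k+1). *)
have sq k : \sum_(1 <= t < k.+2) (t%:R ^+ 2)^-1 <= 2 - k.+1%:R^-1 :> F.
  elim: k => [|k IH]; first by rewrite big_nat1 expr1n invr1; lra.
  rewrite big_nat_recr //=; apply: le_trans (lerD IH (lexx _)) _.
  have c0 : (0 : F) < k.+1%:R by rewrite ltr0n.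
  have -> : k.+2%:R = k.+1%:R + 1 :> F by rewrite -natr1.
  move: (k.+1%:R) c0 => c c0; rewrite -subr_ge0.
  have -> : 2 - (c + 1)^-1 - (2 - c^-1 + ((c + 1) ^+ 2)^-1) = (c * (c + 1) ^+ 2)^-1.
    by field; apply/andP; split; lra.
  by rewrite invr_ge0 mulr_ge0 ?sqr_ge0 ?ltW.
have A0 : 0 <= n%:R ^+ (L + 2) / L`!%:R :> F by rewrite divr_ge0 ?exprn_ge0.
have [n1|n1] := leqP n 1; first by rewrite big_geq // mulr_ge0.
apply: le_trans (_ : \sum_(1 <= t < n) n%:R ^+ (L + 2) / L`!%:R * (t%:R ^+ 2)^-1 <= _).
  rewrite big_nat [leRHS]big_nat; apply: ler_sum => t /andP[t0 tn].
  by rewrite kernel_le // t0 ltnW.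
rewrite -mulr_sumr mulrC ler_wpM2r // -(subnK n1) addn2 (le_trans (sq _)) //.
by rewrite gerBl invr_ge0 ler0n.
Qed.

End OddChebyshev.

(** * A numerical criterion for reconstructibility *)

(** At the first position i where x and y differ, the kernel shifted to i
    outweighs all later positions together, so the weighted sum of the
    differences cannot vanish. *)
Lemma reconstructible_of_kernel n k L m : (k <= n)%N ->
  ((L + 2) * (2 * m + 1) <= k)%N ->
  (2 * n ^ (L + 3) < L`! * (2 * m + 1) ^ (2 * (L + 2)))%N ->
  all_reconstructible n k.
Proof.
move=> kn Lmk small x y /eqP xy dxy.
pose z (j : 'I_n) : rat := (x j)%:R - (y j)%:R.
have [j0 zj0] : exists j, z j != 0.
  apply: contrapT => /forallNP z0; case/eqP: xy; apply/permP => j.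
  have /negP/negPn := z0 j; rewrite subr_eq0 eqr_nat => /eqP xyj.
  exact: val_inj.
have z_le j : `|z j| <= n%:R.
  by rewrite ler_norml; have := ltn_ord (x j); have := ltn_ord (y j);
     rewrite -!(ltr_nat rat) /z => ? ?; have := ler0n rat (x j); have := ler0n rat (y j);
     move=> ? ?; apply/andP; split; lra.
(* z j is the image of an integer. *)
have z_ge j : z j != 0 -> 1 <= `|z j|.
  rewrite /z -[(x j)%:R]/((x j)%:Z%:~R) -[(y j)%:R]/((y j)%:Z%:~R) -intrB.
  by rewrite -intr_norm intr_eq0 ler1z -normr_gt0 gtz0_ge1.
case: (arg_minnP (P := fun j => z j != 0) (fun j : 'I_n => val j) zj0) => i zi imin.
pose g := kernel rat L m n \Po ('X - (i : nat)%:R%:P).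
have gE t : g.[t] = (kernel rat L m n).[t - i%:R].
  by rewrite horner_comp hornerD hornerN hornerX hornerC.
have sg : (size g < k)%N.
  rewrite size_comp_poly2 ?size_XsubC //.
  by apply: leq_ltn_trans (size_kernel _ _ _ _) _; lia.
have /eqP := deck_poly_sum j0 kn sg dxy.
rewrite (bigD1 i) //= -/(z i) gE subrr kernel_at0 addr_eq0 => /eqP eq0.
have up : `|z i * (2 * m + 1)%:R ^+ (2 * (L + 2))| <=
    n%:R * (2 * (n%:R ^+ (L + 2) / L`!%:R)).
  rewrite eq0 normrN.
  apply: le_trans (_ : n%:R * \sum_(1 <= t < n) `|(kernel rat L m n).[t%:R]| <= _); last first.
    by rewrite ler_wpM2l // kernel_sum_le.
  apply: le_trans (ler_norm_sum _ _ _) _.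
  apply: le_trans (_ : \sum_(j < n | (i < j)%N) n%:R * `|(kernel rat L m n).[(j - i)%:R]| <= _).
    rewrite big_mkcond [leRHS]big_mkcond /=; apply: ler_sum => j _.
    rewrite -/(z j) gE; case: (ltngtP i j) => [ij|ji|/val_inj <-]; rewrite ?eqxx //.
    - by rewrite (_ : j != i) ?normrM -?natrB ?ler_wpM2r // 1?ltnW // neq_ltn ij orbT.
    - have -> : z j = 0; last by rewrite mul0r normr0 if_same.
      by apply/eqP; apply: contraTT ji => /imin; rewrite -leqNgt.
  rewrite -mulr_sumr ler_wpM2l //.
  have shift (h : nat -> rat) : (forall t, 0 <= h t) ->
    \sum_(j < n | (i < j)%N) h (j - i)%N <= \sum_(1 <= t < n) h t; last first.
    exact: (shift (fun t => `|(kernel rat L m n).[t%:R]|)).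
  move=> h0.
  have -> : \sum_(j < n | (i < j)%N) h (j - i)%N = \sum_(1 <= t < n - i) h t.
    rewrite -(big_geq_mkord i.+1 n xpredT (fun j => h (j - i)%N)) -add1n big_addn.
    by apply: eq_bigr => t _; rewrite addnK.
  rewrite [leRHS](@big_cat_nat _ _ _ (n - i)) ?leq_subr ?subn_gt0 //=.
  by rewrite lerDl sumr_ge0.
have : L`!%:R * (2 * m + 1)%:R ^+ (2 * (L + 2)) <= 2 * n%:R ^+ (L + 3) :> rat.
  have Lf : (0 : rat) < L`!%:R by rewrite ltr0n fact_gt0.
  apply: le_trans (_ : L`!%:R * `|z i * (2 * m + 1)%:R ^+ (2 * (L + 2))| <= _).
    by rewrite ler_pM2l // normrM normrX normr_nat ler_peMl ?z_ge ?exprn_ge0.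
  rewrite -ler_pdivlMl // (le_trans up) // [(L + 3)%N]addnS exprS le_eqVlt; apply/orP; left.
  by apply/eqP; move: (n%:R ^+ (L + 2)) => p; move: (L`!%:R^-1) => q; ring.
by rewrite -!natrX -!natrM (ler_nat rat) leqNgt small.
Qed.

(** * Choice of the parameters *)

Section Asymptotics.
Variable R : realType.
Implicit Types (x c : R) (n d L m : nat).

(** From e^(-1/16) >= 15/16, raised to the power 16. *)
Lemma expR1_le : expR 1 <= 141 / 50 :> R.
Proof.
have e16 : expR (16^-1) <= 16 / 15 :> R.
  have := expR_ge1Dx (- 16^-1 : R); rewrite expRN => H.
  rewrite -[expR _]invrK -[leRHS]invrK lef_pV2 ?posrE ?invr_gt0 ?expR_gt0 //.
    by apply: le_trans H; lra.
  by lra.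
have -> : (1 : R) = 16%:R * 16^-1 by lra.
rewrite expRM_natl; apply: le_trans (_ : (16 / 15) ^+ 16 <= _); last by lra.
by rewrite lerXn2r ?nnegrE ?expR_ge0 //; lra.
Qed.

Lemma linear_le_expR c x : 0 <= c -> 2 * c <= x -> c * x <= expR x.
Proof.
move=> c0 cx; have x0 : 0 <= x by lra.
by have := expR_ge1Dxn 1 x0; rewrite (_ : 2`!%:R = 2) //; nra.
Qed.

(** L^L / L! is one term of the exponential series at L. *)
Lemma fact_ge L : L%:R ^+ L <= L`!%:R * expR L%:R :> R.
Proof.
case: L => [|L]; first by rewrite expr0 fact0 expR0 mulr1.
have := expR_ge1Dxn L (ler0n R L.+1).
have f0 : (0 : R) < (L.+1)`!%:R by rewrite ltr0n fact_gt0.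
rewrite -ler_pdivrMl // [_^-1 * _]mulrC; apply: le_trans.
by rewrite lerDr.
Qed.

(** A lower bound on ln n beyond which all the estimates below hold; the cubic
    term y^3 / 6 of e^y beats 2 (101 y)^2 once y > 12 * 101^2. *)
Definition log_bound : R := 12 * 101 ^+ 3.

Lemma quadratic_lt_expR x : log_bound < x -> 2 * x ^+ 2 < expR (x / 101).
Proof.
rewrite /log_bound => xb; have x0 : 0 <= x / 101 by lra.
have := expR_ge1Dxn 2 x0; rewrite (_ : 3`!%:R = 6) //; apply: lt_le_trans.
set y := x / 101; have -> : x = 101 * y by rewrite /y; lra.
have yb : 12 * 101 ^+ 2 < y by rewrite /y; lra.
have : 0 <= y ^+ 2 * (y - 12 * 101 ^+ 2) by rewrite mulr_ge0 ?sqr_ge0 //; lra.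
by nra.
Qed.

(** With 1.01 ln n < L, the factor e^L beats 2 n L^2: its part e^(100 L / 101)
    exceeds n and its part e^(L / 101) exceeds 2 L^2.  The constant 2.9 leaves
    room for e * sqrt 1.01 and for rounding L and m up. *)
Lemma exists_params n : log_bound <= ln (n%:R : R) ->
  exists L m, (2 * n ^ (L + 3) < L`! * (2 * m + 1) ^ (2 * (L + 2)))%N /\
    ((L + 2) * (2 * m + 1))%:R <= 29 / 10 * Num.sqrt (n%:R * ln n%:R) :> R.
Proof.
set l := ln _ => lb; have lb' := lb; rewrite /log_bound in lb'.
have N0 : (0 : R) < n%:R.
  by rewrite ltNge; apply/negP => /ln0 l0; move: lb'; rewrite /l l0; lra.
have Nl : n%:R = expR l :> R by rewrite lnK.
have ceil (c : R) : 0 <= c -> exists2 p, c < p%:R & p%:R <= c + 1.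
  move=> c0; exists (Num.truncn c).+1; first exact: truncnS_gt.
  by rewrite -natr1 lerD2r truncn_le.
have [|L Lgt Lle] := ceil (101 / 100 * l); first by lra.
have L0 : (0 : R) < L%:R by lra.
have [q q0 q2] : exists2 q : R, 0 <= q & q ^+ 2 = expR 2 * n%:R / L%:R.
  exists (expR 1 * Num.sqrt (n%:R / L%:R)); first by rewrite mulr_ge0 ?expR_ge0 ?sqrtr_ge0.
  by rewrite exprMn sqr_sqrtr ?divr_ge0 ?ltW // -expRM_natl mulr1 mulrA.
have [|m mgt mle] := ceil (q / 2); first by lra.
have ME : (2 * m + 1)%:R = 2 * m%:R + 1 :> R by rewrite natrD natrM.
exists L, m; split.
  rewrite -(ltr_nat R) !natrM !natrX ME exprM.
  set E := expR (L%:R : R); have E0 : 0 < E by exact: expR_gt0.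
  (* e^L = e^(L/101) * e^(100 L/101), and the second factor exceeds n. *)
  have NLE : 2 * n%:R * L%:R ^+ 2 < E.
    have -> : E = expR (L%:R / 101) * expR (100 / 101 * L%:R).
      by rewrite -expRD; congr expR; lra.
    rewrite mulrAC; apply: ltr_pM; rewrite ?mulr_ge0 ?sqr_ge0 ?ltW //.
      by apply: quadratic_lt_expR; rewrite /log_bound; lra.
    by rewrite Nl ltr_expR; lra.
  have LE : L%:R ^+ (L + 2) * (2 * n%:R) < L`!%:R * E ^+ 2.
    rewrite exprD -mulrA; apply: lt_le_trans (_ : L%:R ^+ L * E <= _).
      by rewrite ltr_pM2l ?exprn_gt0 // mulrC.
    by rewrite expr2 mulrA; apply: ler_wpM2r (fact_ge L); exact: ltW.
  apply: lt_le_trans (_ : L`!%:R * (q ^+ 2) ^+ (L + 2) <= _); last first.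
    rewrite ler_wpM2l // lerXn2r ?nnegrE ?sqr_ge0 // lerXn2r ?nnegrE //; lra.
  have LX : (0 : R) < L%:R ^+ (L + 2) by rewrite exprn_gt0.
  rewrite q2 !exprMn exprVn mulrA ltr_pdivlMr // mulrA.
  have -> : 2 * n%:R ^+ (L + 3) * L%:R ^+ (L + 2) =
      L%:R ^+ (L + 2) * (2 * n%:R) * n%:R ^+ (L + 2) :> R.
    rewrite [(L + 3)%N]addnS exprS.
    by move: (n%:R ^+ (L + 2)) => p; move: (L%:R ^+ (L + 2)) => r; ring.
  rewrite ltr_pM2r ?exprn_gt0 //; apply: lt_le_trans LE _.
  rewrite ler_wpM2l // /E -!expRM_natl ler_expR natrD.
  by have := ler0n R L; lra.
rewrite natrM ME natrD.
set S := Num.sqrt _.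
have S2 : S ^+ 2 = n%:R * l by rewrite sqr_sqrtr // mulr_ge0 ?ltW //; lra.
have S0 : 0 <= S by rewrite sqrtr_ge0.
have lS : 80 * l <= S.
  have := @linear_le_expR 6400 l; rewrite -Nl => H.
  rewrite -(@ler_pXn2r _ 2) ?nnegrE ?S2 //; last by lra.
  by have : 6400 * l <= n%:R; [apply: H; lra|nra].
have Lq : (L%:R + 2) * q <= 285 / 100 * S.
  rewrite -(@ler_pXn2r _ 2) ?nnegrE //; [|by rewrite mulr_ge0 //; lra..].
  rewrite !exprMn q2 S2.
  have e2 : expR 2 <= 796 / 100 :> R.
    have -> : expR 2 = expR 1 ^+ 2 :> R by rewrite -expRM_natl mulr1.
    by have := expR1_le; have := expR_ge0 (1 : R); nra.
  have LL : (L%:R + 2) ^+ 2 <= 102 / 100 * l * L%:R by nra.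
  rewrite !mulrA ler_pdivrMr //.
  have : (L%:R + 2) ^+ 2 * expR 2 <= 812 / 100 * l * L%:R.
    apply: le_trans (_ : 102 / 100 * l * L%:R * (796 / 100) <= _).
      by apply: ler_pM; rewrite ?sqr_ge0 ?expR_ge0 //; lra.
    by have : 0 <= l * L%:R; [rewrite mulr_ge0 //|]; lra.
  by nra.
have : (L%:R + 2) * 3 <= 4 * l by lra.
have : (L%:R + 2) * (2 * m%:R + 1) <= (L%:R + 2) * (q + 3).
  by rewrite ler_wpM2l //; lra.
by lra.
Qed.

(** If n <= 1.02 d, then n ln n <= (1.02)^2 d ln d and 2.9 * 1.02 < 3; otherwise
    n - d is at least a constant fraction of n, which exceeds sqrt(n ln n) by
    any factor. *)
Lemma minor_length_large n d : log_bound <= ln (d%:R : R) ->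
  d%:R + 3 * Num.sqrt (d%:R * ln d%:R) - 1 < n%:R :> R ->
  29 / 10 * Num.sqrt (n%:R * ln n%:R) <= n%:R - d%:R :> R.
Proof.
set l := ln d%:R; set s := Num.sqrt (d%:R * l) => lb dn.
have lb' := lb; rewrite /log_bound in lb'.
have d0 : (0 : R) < d%:R.
  by rewrite ltNge; apply/negP => /ln0 l0; move: lb'; rewrite /l l0; lra.
have dl : d%:R = expR l :> R by rewrite lnK.
have s2 : s ^+ 2 = d%:R * l by rewrite sqr_sqrtr // mulr_ge0 ?ltW //; lra.
have s0 : 0 <= s by exact: sqrtr_ge0.
have s_ge : 100 <= s.
  have := @linear_le_expR 1 l; rewrite -dl => H.
  rewrite -(@ler_pXn2r _ 2) ?nnegrE ?s2 //.
  by have : 1 * l <= d%:R; [apply: H; lra|nra].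
have n0 : (0 : R) < n%:R by lra.
have ln_le : ln n%:R <= l + ln (n%:R / d%:R) :> R.
  by rewrite -lnM ?posrE ?divr_gt0 // mulrC divfK // gt_eqF.
have lnn : l <= ln n%:R by rewrite ler_ln ?posrE //; lra.
have [nd|nd] := leP (n%:R : R) (102 / 100 * d%:R).
  have ln_le2 : ln n%:R <= 102 / 100 * l :> R.
    have : ln (n%:R / d%:R) <= ln (1 + 2 / 100) :> R.
      by rewrite ler_ln ?posrE ?divr_gt0 // ?ler_pdivrMr //; lra.
    have : ln (1 + 2 / 100) <= 2 / 100 :> R by apply: le_ln1Dx; lra.
    by lra.
  have : Num.sqrt (n%:R * ln n%:R) <= 102 / 100 * s.
    rewrite -(@ler_pXn2r _ 2) ?nnegrE ?sqrtr_ge0 //; last by lra.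
    rewrite exprMn s2 sqr_sqrtr; last by apply: mulr_ge0; lra.
    apply: le_trans (_ : 102 / 100 * d%:R * (102 / 100 * l) <= _); last by lra.
    by apply: ler_pM => //; lra.
  by lra.
have nl : n%:R = expR (ln n%:R) :> R by rewrite lnK.
have small : 200 ^+ 2 * ln n%:R <= n%:R :> R.
  by rewrite [leRHS]nl; apply: linear_le_expR; lra.
have : Num.sqrt (n%:R * ln n%:R) <= n%:R / 150 :> R.
  rewrite -(@ler_pXn2r _ 2) ?nnegrE ?sqrtr_ge0 //; last by lra.
  by rewrite sqr_sqrtr; [nra|rewrite mulr_ge0 ?ltW //; lra].
by lra.
Qed.

End Asymptotics.

Theorem mainTheorem3 (R : realType) :
  exists d0 : nat, forall d : nat, (d0 <= d)%N ->
    exists N : nat, is_Nd d N /\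
      N%:R <= d%:R + 3 * Num.sqrt (d%:R * ln d%:R) :> R.
Proof.
exists (Num.truncn (expR (log_bound R))).+1 => d dge.
have bound_le n : (d <= n)%N -> log_bound R <= ln (n%:R : R).
  move=> dn; rewrite -[leLHS]expRK ler_ln ?posrE ?expR_gt0 //.
    by rewrite (le_trans (ltW (truncnS_gt _))) // ler_nat (leq_trans dge).
  by rewrite ltr0n (leq_trans _ dn) // (leq_trans _ dge).
have dln := bound_le d (leqnn d).
set B := d%:R + _.
have dl1 : 1 <= d%:R * ln d%:R :> R.
  have d1 : 1 <= d%:R :> R by rewrite ler1n (leq_trans _ dge).
  have l1 : 1 <= ln d%:R :> R by move: dln; rewrite /log_bound; lra.
  by nra.
have B_gt : d%:R + 1 <= B.
  have s1 : 1 <= Num.sqrt (d%:R * ln d%:R) :> R.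
    by rewrite -[leLHS]sqrtr1 ler_sqrt //; lra.
  by rewrite lerD2l; lra.
have B0 : 0 <= B by apply: le_trans B_gt; rewrite addr_ge0.
have adm : admissible d (Num.truncn B).
  split; first by rewrite truncn_gt_nat -natr1.
  move=> n Bn.
  have dn : (d < n)%N.
    by apply: leq_trans Bn; rewrite truncn_gt_nat -natr1.
  have nB : B - 1 < n%:R.
    by rewrite ltrBlDr natr1 (lt_le_trans (truncnS_gt B)) // ler_nat.
  have [L [m [small deg]]] := exists_params (bound_le n (ltnW dn)).
  apply: (reconstructible_of_kernel (leq_subr _ _) _ small).
  rewrite -(ler_nat R) natrB; last exact: ltnW.
  exact: le_trans deg (minor_length_large dln nB).
(* The least admissible N is at most the integer part of the bound. *)
pose P N := `[< admissible d N >].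
have exP : exists N, P N by exists (Num.truncn B); apply/asboolP.
case: (ex_minnP exP) => N /asboolP admN minN; exists N; split.
  by split=> // M admM; apply: minN; apply/asboolP.
apply: le_trans (_ : (Num.truncn B)%:R <= _); last by rewrite truncn_le.
by rewrite ler_nat; apply: minN; apply/asboolP.
Qed.
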